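(* Let $X$ be a real Banach space and let $\mathcal{C}$ be a compatible class of bounded subsets of $X$. The following are equivalent: (a) $X$ has the $\mathcal{C}$-UMIP. (b) For every $\varepsilon>0$ there exists $0<\delta<1$ such that for every $C\in\mathcal{C}$ with $C\subseteq B(X)$ and every $f\in S(X^* )$, there is $x\in S(X)$ such that $$S(B(X^* ),x,\delta)\subseteq \operatorname{cone}(B_C(f,\varepsilon)).$$
   Context: $B(X)=\{x:\|x\|\le 1\}$, $S(X)=\{x:\|x\|=1\}$ (similarly for $X^*$); $B[x,r]$ is the closed ball ($r>0$). $d(x,C)=\inf\{\|x-z\|:z\in C\}$. Compatible class: a class $\mathcal{C}$ of bounded subsets of $X$ such that (I) $C\in\mathcal{C}$, $\alpha\in\mathbb{R}$, $x\in X$ imply $\alpha C+x\in\mathcal{C}$ and $C\cup\{x\}\in\mathcal{C}$; (II) $C\in\mathcal{C}$ implies the closed absolutely convex hull of $C$ is in $\mathcal{C}$; (III) $C\in\mathcal{C}$ and $A\subseteq C$ imply $A\in\mathcal{C}$; (IV) $C_1,C_2\in\mathcal{C}$ implies $C_1\cup C_2\in\mathcal{C}$. $\mathcal{C}$-UMIP: for every $\varepsilon>0$ and $M\ge 2$, there exist $K>0$ and $0<\eta\le\varepsilon$ such that for every closed convex $C\in\mathcal{C}$ with $\operatorname{diam}(C)\le M$ and $d(0,C)\ge\varepsilon$, there exist $z_0\in X$ and $0<r\le K$ such that $C\subseteq B[z_0,r]$ and $d(0,B[z_0,r])\ge\eta$. For bounded $A\subseteq X$ and $f\in X^*$, $\|f\|_A=\sup\{|f(x)|:x\in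 A\}$, and $B_A(f,\varepsilon)=\{g\in X^*:\|f-g\|_A<\varepsilon\}$. For $x\in S(X)$ and $0<\delta<1$, $S(B(X^* ),x,\delta)=\{f\in B(X^* ): f(x)>1-\delta\}$ (a w*-slice). For a subset $A$ of a vector space, $\operatorname{cone}(A)=\{\lambda a:\lambda\ge 0,\ a\in A\}$. *)

(* Defs.v *)
From HB Require Import structures.
From mathcomp Require Import all_boot all_order all_algebra.
From mathcomp Require Import all_classical all_reals all_analysis.

Set Implicit Arguments.
Unset Strict Implicit.
Unset Printing Implicit Defensive.

Import Order.TTheory GRing.Theory Num.Theory.
Import numFieldNormedType.Exports.

Local Open Scope classical_set_scope.
Local Open Scope ring_scope.

Section Primal.
Context {R : realType} {X : normedModType R}.
Implicit Types (A C : set X) (x z : X).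

Definition unit_ball : set X := [set x | `|x| <= 1].

Definition unit_sphere : set X := [set x | `|x| = 1].

(* [inf] and [sup] are real-valued with value 0 on [set0]; below, [dist_set] is
   only used with nonempty sets and [diam] with nonempty bounded sets. *)
Definition dist_set x A : R := inf [set `|x - z| | z in A].

Definition diam A : R := sup [set `|u.1 - u.2| | u in A `*` A].

Definition balanced A :=
  forall (a : R) x, `|a| <= 1 -> A x -> A (a *: x).

Definition absolutely_convex A := @convex_set R X A /\ balanced A.

Definition closed_absolutely_convex_hull A : set X :=
  smallest [set C | closed C /\ absolutely_convex C] A.

Record compatible_class (CC : set (set X)) : Prop := CompatibleClass {
  compatible_bounded : forall C, CC C -> bounded_set C ;
  compatible_affine : forall C (a : R) x,
    CC C -> CC [set a *: c + x | c in C] ;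
  compatible_setU1 : forall C x, CC C -> CC (C `|` [set x]) ;
  compatible_hull : forall C, CC C -> CC (closed_absolutely_convex_hull C) ;
  compatible_subset : forall C A, CC C -> A `<=` C -> CC A ;
  compatible_setU : forall C1 C2, CC C1 -> CC C2 -> CC (C1 `|` C2) }.

(* The sets [C] are taken nonempty: [set0] may belong to [CC], and with
   d(0, set0) = +oo it would only matter for X = {0}, where every ball
   contains 0. *)
Definition UMIP (CC : set (set X)) :=
  forall eps M : R, 0 < eps -> 2 <= M ->
  exists K eta : R, [/\ 0 < K, 0 < eta <= eps &
    forall C, CC C -> C !=set0 -> closed C -> @convex_set R X C ->
      diam C <= M -> eps <= dist_set 0 C ->
      exists (z0 : X) (r : R), [/\ 0 < r <= K, C `<=` closed_ball z0 r &
        eta <= dist_set 0 (closed_ball z0 r)]].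

End Primal.

Definition cone {R : realType} {V : lmodType R} (A : set V) : set V :=
  [set v | exists l a, [/\ 0 <= l, A a & v = l *: a]].

Section Dual.
Context {R : realType} {X : normedModType R}.
Implicit Types (A : set X) (f g : X -> R^o) (x : X).

(* The dual X* is carried by a subset of the vector space of all functions
   X -> R, whose operations are pointwise. *)
Definition dual : set (X -> R^o) := [set f | linear f /\ continuous f].

Definition norm_on A f : R := sup [set `|f x| | x in A].

Definition dual_norm f : R := norm_on unit_ball f.

Definition dual_unit_ball : set (X -> R^o) :=
  [set f | dual f /\ dual_norm f <= 1].

Definition dual_unit_sphere : set (X -> R^o) :=
  [set f | dual f /\ dual_norm f = 1].

Definition ball_on A f (eps : R) : set (X -> R^o) :=
  [set g | dual g /\ norm_on A (f - g) < eps].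

Definition weak_star_slice x (delta : R) : set (X -> R^o) :=
  [set f | dual_unit_ball f /\ 1 - delta < f x].

End Dual.

(* Main.v *)
Require Import Defs.
From HB Require Import structures.
From mathcomp Require Import all_boot all_order all_algebra.
From mathcomp Require Import all_classical all_reals all_analysis.
From mathcomp Require Import ring lra.

Set Implicit Arguments.
Unset Strict Implicit.
Unset Printing Implicit Defensive.

Import Order.TTheory GRing.Theory Num.Theory.
Import numFieldNormedType.Exports.

Local Open Scope classical_set_scope.
Local Open Scope ring_scope.

(* (a) => (b).  Let D be the closed absolutely convex hull of C and of a point
   of the unit ball at which f is close to 1.  A ball B[z, r] that separates
   {a in D | f a >= e} from 0 gives x = z / |z|: every g in a thin slice at x
   is positive on that set, and then Phelps' parallel functional argument,
   relative to D, makes f uniformly close on D to a positive multiple of g.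
   (b) => (a).  If C has a point far from 0, a ball centered there will do.
   Otherwise rescale C into the unit ball and let f separate C from 0.  All
   functionals of the slice at x are nonnegative on C; perturbing them by a
   multiple of f, those of a thinner slice are bounded away from 0 on C.  For
   t large, B[t x, t - eta] then contains C: a functional that norms t x - c
   is either in the thinner slice or too small at t x. *)

(** * Convex sets *)

Lemma convex_setP (R : realType) (V : lmodType R) (A : set V) :
  @convex_set R V A <->
  (forall x y (t : R), A x -> A y -> 0 <= t -> t <= 1 ->
    A (t *: x + (1 - t) *: y)).
Proof.
split=> [cA x y t Ax Ay t0 t1|cA x y t /set_mem Ax /set_mem Ay].
  exact: set_mem (cA x y (Itv01 t0 t1) (mem_set Ax) (mem_set Ay)).
by apply: mem_set; apply: (cA x y t%:num).
Qed.

(** Merges nonnegative multiples of two points of [A] into one multiple, which gives subadditivity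
    in [sublinear_lower_on]. Keeping the factor [s + t] on the right covers the case [s = t = 0]. *)
Lemma convex_set_comb (R : realType) (V : lmodType R) (A : set V) (x y : V)
    (s t : R) : @convex_set R V A -> A x -> A y -> 0 <= s -> 0 <= t ->
  exists2 z, A z & s *: x + t *: y = (s + t) *: z.
Proof.
move=> /convex_setP cA Ax Ay s0 t0; have [st0|stN0] := eqVneq (s + t) 0.
  have [-> ->] : s = 0 /\ t = 0 by split; lra.
  by exists x => //; rewrite addr0 !scale0r addr0.
exists (s / (s + t) *: x + (1 - s / (s + t)) *: y).
  apply: cA => //; first by rewrite divr_ge0 ?addr_ge0.
  by rewrite ler_pdivrMr ?mul1r ?lerDl // lt0r stN0 addr_ge0.
by rewrite scalerDr !scalerA; congr (_ *: _ + _ *: _); field.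
Qed.

(** * Sublinear maps and the Hahn-Banach theorem *)

Definition sublinear (R : realType) (V : lmodType R) (p : V -> R) :=
  (forall x y, p (x + y) <= p x + p y) /\
  (forall (a : R) x, 0 <= a -> p (a *: x) <= a * p x).

Section Sublinear.
Context {R : realType} {V : lmodType R}.
Implicit Types (p q : V -> R) (x y : V).

Lemma sublinear0 p : sublinear p -> p 0 = 0.
Proof.
move=> [pD pZ]; have := pD 0 0; have := pZ 0 0 (lexx 0).
rewrite scale0r addr0; lra.
Qed.

Lemma sublinear_geN p x : sublinear p -> - p (- x) <= p x.
Proof.
by move=> sp; have := sp.1 x (- x); rewrite subrr sublinear0//; lra.
Qed.

(** With [sublinear_geN] the hypothesis makes [p] odd; the two inequalities of sublinearity, applied
    to negatives, then reverse. *)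
Lemma sublinear_odd_linear p : sublinear p -> (forall x, p (- x) <= - p x) ->
  linear (p : V -> R^o).
Proof.
move=> sp pN; have pE x : p (- x) = - p x.
  by apply/eqP; rewrite eq_le pN/= lerNl sublinear_geN.
have pD x y : p (x + y) = p x + p y.
  apply/eqP; rewrite eq_le sp.1/=.
  by have := sp.1 (- x) (- y); rewrite -opprD !pE; lra.
have pZ0 (a : R) x : 0 <= a -> p (a *: x) = a * p x.
  move=> a0; apply/eqP; rewrite eq_le sp.2//=.
  by have := sp.2 a (- x) a0; rewrite scalerN !pE; lra.
move=> a x y; rewrite pD; congr (_ + _).
have [a0|/ltW a0] := leP 0 a; first exact: pZ0.
by rewrite -[a]opprK scaleNr pE pZ0 ?oppr_ge0// scaleNr.
Qed.

(** Common to the two infima taken below: over a convex set of translations, and over a chain of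
    sublinear maps. *)
Lemma sublinear_inf (S : V -> set R) :
  (forall x, S x !=set0) -> (forall x, has_lbound (S x)) ->
  (forall x y a b, S x a -> S y b -> exists2 c, S (x + y) c & c <= a + b) ->
  (forall (t : R) x a, 0 <= t -> S x a ->
    exists2 c, S (t *: x) c & c <= t * a) ->
  sublinear (fun x => inf (S x)).
Proof.
move=> S0 Sb SD SZ; split=> [x y|t x t0].
  rewrite -lerBlDr; apply: lb_le_inf => // a Sa.
  rewrite lerBlDr -lerBlDl; apply: lb_le_inf => // b Sb'.
  rewrite lerBlDl; have [c Sc] := SD _ _ _ _ Sa Sb'.
  by apply: le_trans; exact: ge_inf.
have [->|tN0] := eqVneq t 0.
  have [a Sa] := S0 x; have [c Sc] := SZ _ _ _ (lexx 0) Sa.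
  by rewrite !mul0r; apply: le_trans; exact: ge_inf.
have {tN0}t0' : 0 < t by rewrite lt0r tN0.
rewrite mulrC -ler_pdivrMr//; apply: lb_le_inf => // a Sa.
rewrite ler_pdivrMr// mulrC; have [c Sc] := SZ _ _ _ t0 Sa.
by apply: le_trans; exact: ge_inf.
Qed.

(** The map [q] is the infimum of [p (x + t *: a) - t * e] over [t >= 0] and [a] in [A]: [t = 0]
    gives [q <= p], and [t = 1] at [- a] gives the bound on [A]. *)
Lemma sublinear_lower_on p (A : set V) (e : R) : sublinear p ->
  @convex_set R V A -> A !=set0 -> (forall a, A a -> e <= p a) ->
  exists q, [/\ sublinear q, forall x, q x <= p x &
    forall a, A a -> q (- a) <= - e].
Proof.
move=> sp cA [a0 Aa0] eA.
pose S x := [set b | exists t a, [/\ 0 <= t, A a & b = p (x + t *: a) - t * e]].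
have Sb x : has_lbound (S x).
  exists (- p (- x)) => _ [t [a [t0 Aa ->]]].
  (* Homogeneity is only an inequality; applied with the factor [t^-1] to [t *: a] it gives the
     direction wanted here. *)
  have : t * e <= p (t *: a).
    have [->|tN0] := eqVneq t 0; first by rewrite mul0r scale0r sublinear0.
    have t0' : 0 < t by rewrite lt0r tN0.
    rewrite -ler_pdivlMl//; apply: le_trans (eA _ Aa) _.
    have ti : 0 <= t^-1 by rewrite invr_ge0.
    by have := sp.2 _ (t *: a) ti; rewrite scalerA mulVf// scale1r.
  by have := sp.1 (x + t *: a) (- x); rewrite addrAC subrr add0r; lra.
have Sp x b t a : 0 <= t -> A a -> p (x + t *: a) - t * e <= b ->
    inf (S x) <= b.
  by move=> t0 Aa; apply: le_trans; apply: ge_inf => //; exists t, a.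
exists (fun x => inf (S x)); split.
- apply: sublinear_inf => //.
  + by move=> x; exists (p (x + 0 *: a0) - 0 * e); exists 0, a0.
  + move=> x y _ _ [t [a [t0 Aa ->]]] [s [b [s0 Ab ->]]].
    have [c Ac abc] := convex_set_comb cA Aa Ab t0 s0.
    exists (p (x + y + (t + s) *: c) - (t + s) * e).
      by exists (t + s), c; split => //; exact: addr_ge0.
    by rewrite -abc addrACA; have := sp.1 (x + t *: a) (y + s *: b); lra.
  + move=> s x _ s0 [t [a [t0 Aa ->]]].
    exists (p (s *: x + (s * t) *: a) - (s * t) * e).
      by exists (s * t), a; split => //; exact: mulr_ge0.
    by rewrite -scalerA -scalerDr; have := sp.2 s (x + t *: a) s0; lra.
- by move=> x; apply: (Sp _ _ 0 a0) => //; rewrite scale0r mul0r addr0 subr0.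
- move=> a Aa; apply: (Sp _ _ 1 a) => //.
  by rewrite scale1r addNr sublinear0// mul1r sub0r.
Qed.

(** Zorn's lemma: the pointwise infimum of a chain is sublinear, and finite because every sublinear
    map below [p] is at least [- p (- x)] at [x]. *)
Lemma sublinear_minimal p : sublinear p ->
  exists q, [/\ sublinear q, forall x, q x <= p x &
    forall r, sublinear r -> (forall x, r x <= q x) -> forall x, q x <= r x].
Proof.
move=> sp; pose P (q : V -> R) := sublinear q /\ forall x, q x <= p x.
pose T := {q | P q}; pose p0 : T := exist P p (conj sp (fun=> lexx _)).
(* The order is reversed, so that a maximal element is a minimal map. *)
pose below (q r : T) := `[< forall x, sval r x <= sval q x >].
have [||F totF|q minq] := @ZL_preorder T p0 below.
- by move=> q; apply/asboolP.
- move=> q r s /asboolP qr /asboolP rs; apply/asboolP => x.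
  exact: le_trans (rs x) (qr x).
- have [[q0 Fq0]|F0] := pselect (F !=set0); last first.
    exists p0 => s Fs.
    by exfalso; apply: F0; exists s.
  pose S x := [set sval q x | q in F].
  have Sb x : has_lbound (S x).
    exists (- p (- x)) => _ [q Fq <-].
    apply: le_trans (sublinear_geN _ (svalP q).1); rewrite lerN2.
    exact: (svalP q).2.
  have sS : sublinear (fun x => inf (S x)).
    apply: sublinear_inf => //.
    + by move=> x; exists (sval q0 x); exists q0.
    (* The smaller of the two maps of the chain serves at [x + y]. *)
    + move=> x y _ _ [q Fq <-] [r Fr <-].
      have [/asboolP qr|/asboolP rq] := totF _ _ Fq Fr.
      * exists (sval r (x + y)); first by exists r.
        by apply: le_trans ((svalP r).1.1 _ _) _; rewrite lerD2r.
      * exists (sval q (x + y)); first by exists q.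
        by apply: le_trans ((svalP q).1.1 _ _) _; rewrite lerD2l.
    + move=> t x _ t0 [q Fq <-]; exists (sval q (t *: x)); first by exists q.
      exact: (svalP q).1.2.
  have Sp x : inf (S x) <= p x.
    apply: le_trans ((svalP q0).2 x); apply: ge_inf => //.
    by exists q0.
  exists (exist P _ (conj sS Sp)) => q Fq; apply/asboolP => x /=.
  by apply: ge_inf => //; exists q.
- exists (sval q); split; [exact: (svalP q).1|exact: (svalP q).2|].
  move=> r sr rq x.
  have rp y : r y <= p y by apply: le_trans (rq y) _; exact: (svalP q).2.
  by have /asboolP := minq (exist P r (conj sr rp)) (asboolT rq); apply.
Qed.

(* A minimal sublinear map is linear: lowering it on a singleton does not
   change it. *)
Lemma hahn_banach_on p (A : set V) (e : R) : sublinear p ->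
  @convex_set R V A -> A !=set0 -> (forall a, A a -> e <= p a) ->
  exists f : V -> R^o, [/\ linear f, forall x, f x <= p x &
    forall a, A a -> e <= f a].
Proof.
(* Lowering on [A] comes first: a linear map below [q] is then at least [e] on [A]. *)
move=> sp cA A0 eA; have [q [sq qp qA]] := sublinear_lower_on sp cA A0 eA.
have [f [sf fq minf]] := sublinear_minimal sq.
have lf : linear (f : V -> R^o).
  apply: sublinear_odd_linear => // y.
  (* Lowering [f] on the singleton of [y] at level [f y] gives [r (- y) <= - f y], and minimality
     gives [f (- y) <= r (- y)]. *)
  have [||_ ->|r [sr rf ry]] := @sublinear_lower_on f [set y] (f y) sf.
  - apply/(@convex_setP R V) => _ _ t -> -> _ _ /=.
    by rewrite -scalerDl addrC subrK scale1r.
  - by exists y.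
  - by [].
  - exact: le_trans (minf r sr rf _) (ry y erefl).
exists f; split => // [x|a Aa]; first exact: le_trans (fq x) (qp x).
have -> : f a = - f (- a).
  have := lf (-1) a 0; rewrite scaleN1r addr0 sublinear0// addr0 scaleN1r => ->.
  by rewrite opprK.
by rewrite lerNr; apply: le_trans (fq _) (qA _ Aa).
Qed.

End Sublinear.

(** * Algebra of linear functionals *)

Section LinearFunctional.
Context {R : realType} {V : lmodType R} {f : V -> R^o}.
Hypothesis lf : linear f.

Lemma functional0 : f 0 = 0.
Proof.
have := lf 1 0 0; rewrite !scale1r addr0 => /eqP.
by rewrite -subr_eq subrr => /eqP <-.
Qed.

Lemma functionalD x y : f (x + y) = f x + f y.
Proof. by have := lf 1 x y; rewrite !scale1r. Qed.

Lemma functionalZ (a : R) x : f (a *: x) = a * f x.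
Proof. by have := lf a x 0; rewrite functional0 !addr0. Qed.

Lemma functionalN x : f (- x) = - f x.
Proof. by rewrite -scaleN1r functionalZ mulN1r. Qed.

Lemma functionalB x y : f (x - y) = f x - f y.
Proof. by rewrite functionalD functionalN. Qed.

End LinearFunctional.

(** * Dual norms, separation, and parallel functionals *)

Section Dual.
Context {R : realType} {X : normedModType R}.
Implicit Types (A D : set X) (f g : X -> R^o) (x : X).

Lemma dual_of_bound f (M : R) :
  linear f -> (forall x, f x <= M * `|x|) -> dual f.
Proof.
move=> lf fM; split=> //.
pose F : {linear X -> R^o} :=
  HB.pack f (GRing.isLinear.Build R X R^o *:%R f lf).
suff : continuous F by [].
apply/linear_bounded_continuous/bounded_funP => r; exists (`|M| * r) => x xr.
apply: (@le_trans _ _ (`|M| * `|x|)); last exact: ler_wpM2l.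
have MM : M * `|x| <= `|M| * `|x| by rewrite ler_wpM2r// ler_norm.
rewrite ler_norml (le_trans (fM x) MM) andbT lerNl -(functionalN lf).
by apply: le_trans (fM _) _; rewrite normrN.
Qed.

Lemma dual_has_bound f : dual f ->
  exists2 M, 0 <= M & forall x, `|f x| <= M * `|x|.
Proof.
move=> [lf cf].
pose F : {linear X -> R^o} :=
  HB.pack f (GRing.isLinear.Build R X R^o *:%R f lf).
have /linear_boundedP/pinfty_ex_gt0[M M0 FM] : bounded_near F (nbhs 0).
  exact/linear_bounded_continuous.
by exists M; [exact: ltW|exact: FM].
Qed.

Lemma dual_lin f g (a b : R) : dual f -> dual g -> dual (a *: f + b *: g).
Proof.
move=> df dg; have [M M0 fM] := dual_has_bound df.
have [N N0 gN] := dual_has_bound dg.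
apply: (@dual_of_bound _ (`|a| * M + `|b| * N)) => [c x y|x].
  rewrite !fctE /= df.1 dg.1 /GRing.scale/=; ring.
rewrite !fctE; apply: le_trans (ler_norm _) _.
apply: le_trans (ler_normD _ _) _.
by rewrite mulrDl -!mulrA lerD// normrM ler_wpM2l.
Qed.

Lemma le_norm_on A f (M : R) x :
  (forall y, A y -> `|f y| <= M) -> A x -> `|f x| <= norm_on A f.
Proof.
move=> fM Ax; apply: ub_le_sup; last by exists x.
by exists M => _ [y Ay <-]; exact: fM.
Qed.

Lemma norm_on_le A f (M : R) :
  0 <= M -> (forall x, A x -> `|f x| <= M) -> norm_on A f <= M.
Proof.
move=> M0 fM; have [[x Ax]|A0] := pselect (A !=set0).
  apply: ge_sup; first by exists `|f x|, x.
  by move=> _ [y Ay <-]; exact: fM.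
(* On the empty set the supremum is 0 by default, whence the hypothesis [0 <= M]. *)
suff -> : A = set0 by rewrite /norm_on image_set0 sup0.
by apply/seteqP; split => // x Ax; apply: A0; exists x.
Qed.

Lemma le_dual_norm f x : dual f -> `|f x| <= dual_norm f * `|x|.
Proof.
move=> df; have [M M0 fM] := dual_has_bound df.
have [->|x0] := eqVneq x 0; first by rewrite (functional0 df.1) !normr0 mulr0.
have nx : 0 < `|x| by rewrite normr_gt0.
rewrite -ler_pdivrMr//.
have -> : `|f x| / `|x| = `|f (`|x|^-1 *: x)|.
  by rewrite (functionalZ df.1) normrM normfV normr_id mulrC.
apply: (@le_norm_on _ _ M) => [y y1|].
  by apply: le_trans (fM y) _; rewrite ler_piMr.
by rewrite /unit_ball/= normfZV.
Qed.

Lemma dual_norm_ge0 f : dual f -> 0 <= dual_norm f.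
Proof.
move=> df; have [M M0 fM] := dual_has_bound df.
apply: le_trans (normr_ge0 (f 0)) _; apply: (@le_norm_on _ _ M) => [y y1|].
  by apply: le_trans (fM y) _; rewrite ler_piMr.
by rewrite /unit_ball/= normr0.
Qed.

(** Hahn-Banach below the norm gives a nonzero functional of norm at most 1; normalizing it can only
    increase its positive values on [A]. *)
Lemma norm_separation A (e : R) : 0 < e -> @convex_set R X A -> A !=set0 ->
  (forall a, A a -> e <= `|a|) ->
  exists f, dual_unit_sphere f /\ forall a, A a -> e <= f a.
Proof.
move=> e0 cA A0 eA.
have sn : sublinear (fun x : X => `|x|).
  by split=> [x y|a x a0]; [exact: ler_normD|rewrite normrZ ger0_norm].
have [f [lf fn ef]] := hahn_banach_on sn cA A0 eA.
have df : dual f by apply: (@dual_of_bound _ 1) => // x; rewrite mul1r.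
have f1 : dual_norm f <= 1.
  apply: norm_on_le => // x /= x1; rewrite ler_norml (le_trans (fn x) x1) andbT.
  by rewrite lerNl -(functionalN lf) (le_trans (fn _))// normrN.
have f0 : 0 < dual_norm f.
  have [a Aa] := A0; rewrite lt0r dual_norm_ge0// andbT; apply/eqP => f0.
  have := le_trans (ef _ Aa) (ler_norm _); rewrite leNgt => /negP; apply.
  by apply: le_lt_trans (le_dual_norm _ df) _; rewrite f0 mul0r.
have dg : dual ((dual_norm f)^-1 *: f).
  by have := dual_lin (dual_norm f)^-1 0 df df; rewrite scale0r addr0.
exists ((dual_norm f)^-1 *: f); split.
  split=> //; apply/eqP; rewrite eq_le; apply/andP; split.
    apply: norm_on_le => // x x1; rewrite fctE normrZ gtr0_norm ?invr_gt0//.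
    rewrite ler_pdivrMl// mulr1; apply: le_trans (le_dual_norm _ df) _.
    by rewrite ler_piMr// ltW.
  rewrite -(@ler_pM2l _ (dual_norm f))// mulr1 {1}/dual_norm.
  apply: norm_on_le => [|x x1]; first by rewrite mulr_ge0 ?dual_norm_ge0.
  have := le_dual_norm x dg; rewrite fctE normrZ gtr0_norm ?invr_gt0//.
  rewrite ler_pdivrMl// => /le_trans; apply; rewrite ler_wpM2l ?(ltW f0)//.
  by rewrite ler_piMr ?dual_norm_ge0.
move=> a Aa; rewrite fctE; apply: le_trans (ef _ Aa) _.
by rewrite ler_pdivlMl// ler_piMl// (le_trans (ltW e0))// ef.
Qed.

(** If [0] is outside the ball, the point of the ball nearest to it is [(1 - r / |z|) z], of norm
    [|z| - r]; [0] inside the ball contradicts [0 < eta]. *)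
Lemma le_dist_closed_ball (z : X) (r eta : R) : 0 < r -> 0 < eta ->
  (eta <= dist_set 0 (closed_ball z r)) = (r + eta <= `|z|).
Proof.
move=> r0 eta0; rewrite closed_ballE//; apply/idP/idP => [h|h]; last first.
  apply: lb_le_inf => [|_ [y /= zy <-]].
    by exists `|0 - z|, z => //=; rewrite /closed_ball_/= subrr normr0 ltW.
  rewrite sub0r normrN; have := ler_normD (z - y) y; rewrite subrK.
  by move: zy; rewrite /closed_ball_/=; lra.
have inB y : `|z - y| <= r -> eta <= `|y|.
  move=> zy; apply: le_trans h _; apply: ge_inf; last first.
    by exists y => //; rewrite sub0r normrN.
  by exists 0 => _ [x _ <-].
have r0' := ltW r0.
have zr : r < `|z|.
  rewrite ltNge; apply/negP => zr; have := inB 0.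
  by rewrite subr0 normr0 => /(_ zr); rewrite leNgt eta0.
have z0 : 0 < `|z| by apply: lt_trans zr.
pose c := r / `|z|; have cz : c * `|z| = r by rewrite divfK// gt_eqF.
have c0 : 0 <= c by rewrite divr_ge0// ltW.
have c1 : c <= 1 by rewrite ler_pdivrMr// mul1r ltW.
have := inB ((1 - c) *: z).
rewrite {1}scalerBl scale1r opprB addrC subrK !normrZ !ger0_norm ?subr_ge0//.
by rewrite mulrBl cz mul1r => /(_ (lexx _)); rewrite lerBrDl.
Qed.

(* Phelps' lemma relative to [D]: every [a] in [D] is sent into [ker g] by
   subtracting a multiple of some [v] at which [g] nearly attains its supremum
   over [D], which costs at most a factor 3 in the gauge of [D]. *)
Lemma parallel_functionals D f g (e : R) (u : X) : linear f -> linear g ->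
  absolutely_convex D -> (exists M, forall a, D a -> `|g a| <= M) ->
  D u -> 3 * e < f u -> 0 < e ->
  (forall a, D a -> e <= f a -> 0 < g a) ->
  exists2 l : R, 0 < l & forall a, D a -> `|f a - l * g a| <= 3 * e.
Proof.
move=> lf lg [cD bD] [M gM] Du fu e0 gpos.
have DN a : D a -> D (- a).
  by move=> Da; rewrite -scaleN1r; apply: bD => //; rewrite normrN1.
have gu : 0 < g u by apply: gpos => //; lra.
have g0 : 0 < norm_on D g.
  by apply: lt_le_trans gu (le_trans (ler_norm _) _); exact: le_norm_on gM Du.
have [v Dv gv] : exists2 v, D v & norm_on D g < 2 * g v.
  have [||_ [v Dv <-] gv] := @sup_gt _ [set `|g x| | x in D] (norm_on D g / 2).
  - by exists `|g u|, u.
  - by rewrite -/(norm_on D g) ltr_pdivrMr// mulrC mulr_natl mulr2n ltrDl.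
  have [gv0|gv0] := leP 0 (g v).
    by exists v => //; move: gv; rewrite ger0_norm//; lra.
  exists (- v); first exact: DN.
  by move: gv; rewrite ltr0_norm// (functionalN lg); lra.
have gv0 : 0 < g v by lra.
have ker a : D a -> g a = 0 -> `|f a| <= e.
  move=> Da ga; rewrite ler_norml; apply/andP; split; rewrite leNgt; apply/negP.
    move=> fa; have := gpos _ (DN _ Da).
    rewrite (functionalN lf) (functionalN lg) ga oppr0 ltxx => h.
    by apply/notF/h; lra.
  by move=> /ltW fa; have := gpos _ Da fa; rewrite ga ltxx.
pose l := f v / g v.
have near a : D a -> `|f a - l * g a| <= 3 * e.
  (* The choice of [c] puts [a / 3 + (2 / 3) c v] in the kernel of [g]; [|c| <= 1] is where
     [norm_on D g < 2 * g v] enters. *)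
  move=> Da; pose c := - (g a / (2 * g v)).
  have c1 : `|c| <= 1.
    rewrite normrN normrM normfV [`|2 * _|]gtr0_norm ?mulr_gt0//.
    rewrite ler_pdivrMr ?mulr_gt0// mul1r (le_trans _ (ltW gv))//.
    exact: le_norm_on gM Da.
  have : D (3^-1 *: a + (1 - 3^-1) *: (c *: v)).
    by apply: (convex_setP D).1 => //; [exact: bD|lra].
  move=> /ker; rewrite (functionalD lf) (functionalD lg).
  rewrite !(functionalZ lf) !(functionalZ lg).
  have -> : 3^-1 * g a + (1 - 3^-1) * (c * g v) = 0.
    by rewrite /c; field; rewrite gt_eqF.
  move=> /(_ erefl).
  have -> : 3^-1 * f a + (1 - 3^-1) * (c * f v) = 3^-1 * (f a - l * g a).
    by rewrite /c /l; field; rewrite gt_eqF.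
  by rewrite normrM [`|3^-1|]gtr0_norm ?invr_gt0// ler_pdivrMl.
(* If [l <= 0], then [f u - l * g u >= f u > 3 * e], against [near] at [u]. *)
exists l => //; rewrite ltNge; apply/negP => l0.
have := le_trans (ler_norm _) (near _ Du).
have : l * g u <= 0 by rewrite pmulr_lle0.
by lra.
Qed.

End Dual.

(** * Closed absolutely convex hulls *)

Section Hull.
Context {R : realType} {X : normedModType R}.
Implicit Types (C D : set X).

Lemma sub_hull C : C `<=` closed_absolutely_convex_hull C.
Proof. by move=> x Cx D [_ CD]; exact: CD. Qed.

Lemma hull_sub_unit_ball C :
  C `<=` unit_ball -> closed_absolutely_convex_hull C `<=` unit_ball.
Proof.
move=> C1 x; apply; split=> //; split.
  rewrite (_ : unit_ball = closed_ball_ Num.norm (0 : X) 1).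
    exact: closed_closed_ball_.
  by apply/seteqP; split=> y; rewrite /unit_ball/closed_ball_/= sub0r normrN.
split=> [|a y a1 y1]; last by rewrite /unit_ball/= normrZ mulr_ile1.
apply/convex_setP => y z t y1 z1 t0 t1; rewrite /unit_ball /=.
apply: le_trans (ler_normD _ _) _; rewrite !normrZ !ger0_norm ?subr_ge0//.
have : t * `|y| <= t by rewrite ler_piMr.
have : (1 - t) * `|z| <= 1 - t by rewrite ler_piMr// subr_ge0.
by lra.
Qed.

Lemma closed_hull C : closed (closed_absolutely_convex_hull C).
Proof. by apply: closed_bigI => D [[cD _] _]. Qed.

Lemma absolutely_convex_hull C :
  absolutely_convex (closed_absolutely_convex_hull C).
Proof.
split=> [|a x a1 Cx D DC].
  2: by have [[_ [_ bD]] _] := DC; apply: bD (Cx _ DC).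
apply/convex_setP => x y t Cx Cy t0 t1 D DC.
have [[_ [/convex_setP cD _]] _] := DC.
by apply: cD => //; [exact: Cx|exact: Cy].
Qed.

End Hull.

Section Equivalence.
Context {R : realType} {X : normedModType R}.
Variable CC : set (set X).
Hypothesis hCC : compatible_class CC.

Let slices_in_cones := forall eps : R, 0 < eps ->
    exists delta : R, 0 < delta < 1 /\
      forall C : set X, CC C -> C `<=` unit_ball ->
      forall f : X -> R^o, dual_unit_sphere f ->
      exists x : X, unit_sphere x /\
        weak_star_slice x delta `<=` cone (ball_on C f eps).

(** * From separating balls to slices *)

Lemma UMIP_slices_in_cones : UMIP CC -> slices_in_cones.
Proof.
(* [3 * e < 1] yields a point [u] of the unit ball with [f u > 3 * e], and [3 * e < eps] absorbs the
   constant of [parallel_functionals]. *)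
move=> umip eps eps0; pose e := Num.min eps 1 / 4.
have e0 : 0 < e by rewrite divr_gt0// lt_min eps0 ltr01.
have [e1 e_eps] : 4 * e <= 1 /\ 4 * e <= eps.
  by rewrite /e mulrC divfK//; split; rewrite ge_min lexx ?orbT.
(* The set to be separated lies in the unit ball, so has diameter at most 2, and [f >= e] on it
   keeps it at distance [e] from [0]. *)
have [K [eta [K0 /andP[eta0 eta_e] sepK]]] := umip e 2 e0 (lexx 2).
(* The center satisfies [|z| <= 1 + K], so [delta * |z| <= eta / 2]; on the separated set this
   leaves [g a > eta - delta * |z| > 0]. *)
have K1 : 0 < 2 * (1 + K) by lra.
pose delta := eta / (2 * (1 + K)).
have delta0 : 0 < delta by rewrite divr_gt0.
have deltaK : 2 * (delta * (1 + K)) = eta by rewrite /delta; field; lra.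
exists delta; split.
  by rewrite delta0/= ltr_pdivrMr// mul1r; lra.
move=> C CCC C1 f [df f1].
have [u u1 fu] : exists2 u, `|u| <= 1 & 3 * e < f u.
  have [||_ [u u1 <-] fu] := @sup_gt _ [set `|f x| | x in unit_ball] (3 * e).
  - by exists `|f 0|, 0 => //; rewrite /unit_ball/= normr0.
  - by rewrite -/(norm_on _ f) -/(dual_norm f) f1; lra.
  have [fu0|fu0] := leP 0 (f u).
    by exists u => //; move: fu; rewrite ger0_norm.
  exists (- u); first by rewrite normrN.
  by move: fu; rewrite ltr0_norm// (functionalN df.1).
pose D := closed_absolutely_convex_hull (C `|` [set u]).
have D1 : D `<=` unit_ball.
  by apply: hull_sub_unit_ball => x [/C1//|->].
have Du : D u by apply: sub_hull; right.
have [cD bD] : absolutely_convex D by exact: absolutely_convex_hull.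
have f_le x : f x <= `|x|.
  apply: le_trans (ler_norm _) (le_trans (le_dual_norm _ df) _).
  by rewrite f1 mul1r.
pose A := D `&` [set a | e <= f a].
have A0 : A !=set0 by exists u; split => //=; lra.
have [|||||z [r [/andP[r0 rK] Azr]]] := sepK A _ A0.
- have CCD := compatible_hull hCC (compatible_setU1 hCC u CCC).
  by apply: compatible_subset CCD _ => // x [].
- apply: closedI; first exact: closed_hull.
  by apply: (preimage_closed _ (@closed_ge _ _)) => y _; exact: df.2.
- apply/convex_setP => x y t [Dx ex] [Dy ey] t0 t1; split.
    exact: (convex_setP D).1.
  rewrite /= (functionalD df.1) !(functionalZ df.1).
  have : t * e <= t * f x by rewrite ler_wpM2l.
  have : (1 - t) * e <= (1 - t) * f y by rewrite ler_wpM2l// subr_ge0.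
  by lra.
- apply: ge_sup; first by have [a Aa] := A0; exists `|a - a|, (a, a).
  move=> _ [[a b] [[/D1 a1 _] [/D1 b1 _]] <-] /=.
  by apply: le_trans (ler_normB _ _) _; move: a1 b1; rewrite /unit_ball/=; lra.
- apply: lb_le_inf => [|_ [a [_ ea] <-]].
    by have [a Aa] := A0; exists `|0 - a|, a.
  by rewrite sub0r normrN; exact: le_trans (f_le a).
rewrite le_dist_closed_ball// => zr.
have z0 : 0 < `|z| by lra.
exists (`|z|^-1 *: z); split.
  by rewrite /unit_sphere/= normfZV// -normr_gt0.
move=> g [[dg g1]].
rewrite (functionalZ dg.1) ltr_pdivlMl// => gz.
have gpos a : D a -> e <= f a -> 0 < g a.
  move=> Da ea; have := Azr a (conj Da ea).
  rewrite closed_ballE// /closed_ball_/= => zar.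
  have : g (z - a) <= `|z - a|.
    apply: le_trans (ler_norm _) (le_trans (le_dual_norm _ dg) _).
    by rewrite ler_piMl.
  rewrite (functionalB dg.1) => gza.
  have zK : `|z| <= 1 + K.
    have := ler_normD (z - a) a; rewrite subrK.
    by have := D1 _ Da; rewrite /unit_ball/=; lra.
  have : delta * `|z| <= delta * (1 + K) by rewrite ler_wpM2l// ltW.
  by lra.
have gD : exists M, forall a, D a -> `|g a| <= M.
  exists 1 => a /D1 a1; apply: le_trans (le_dual_norm _ dg) _.
  by rewrite mulr_ile1// dual_norm_ge0.
have [l l0 fg] := parallel_functionals df.1 dg.1 (conj cD bD) gD Du fu e0 gpos.
exists l^-1, (l *: g); split; first by rewrite invr_ge0 ltW.
  split; first by have := dual_lin l 0 dg dg; rewrite scale0r addr0.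
  apply: (@le_lt_trans _ _ (3 * e)); last by lra.
  apply: norm_on_le => [|x Cx]; first by lra.
  by apply: fg; apply: sub_hull; left.
by rewrite scalerA mulVf ?scale1r// gt_eqF.
Qed.

(** * From slices to separating balls *)

Lemma slices_in_cones_UMIP : slices_in_cones -> UMIP CC.
Proof.
move=> slices eps M eps0 M2; pose N := 2 * M.
have N0 : 0 < N by rewrite /N; lra.
(* Scaled back by [N], this error is [eps / 2], so a functional this close to [f >= eps] stays
   positive on [C]. *)
have epsN : 0 < eps / (2 * N) by rewrite divr_gt0// mulr_gt0.
have [delta [/andP[delta0 delta1] sliceC]] := slices _ epsN.
pose eta := Num.min (delta / 4 * eps) 1.
have eta0 : 0 < eta by rewrite lt_min ltr01 andbT mulr_gt0// divr_gt0.
have [eta_eps eta1] : eta <= delta / 4 * eps /\ eta <= 1.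
  by split; rewrite ge_min lexx ?orbT.
(* Chosen so that [g x <= 1 - delta / 2] and [|g c| <= N] force [g (t *: x - c) <= t - eta]. *)
pose t := 2 * (N + eta) / delta.
have tdelta : delta * t = 2 * (N + eta) by rewrite /t; field; lra.
have t_gt : 2 * (N + eta) < t.
  rewrite -tdelta gtr_pMl// /t divr_gt0// mulr_gt0//; lra.
exists (M + t), eta; split; first by rewrite /N in t_gt; lra.
  rewrite eta0/=; apply: le_trans eta_eps _; rewrite ler_piMl ?ltW//; lra.
move=> C CCC C0 _ cC diamC distC.
have diamE a b : C a -> C b -> `|a - b| <= M.
  move=> Ca Cb; apply: le_trans diamC; apply: ub_le_sup; last by exists (a, b).
  have [B [_ CB]] := compatible_bounded hCC CCC.
  exists (B + 1 + (B + 1)) => _ [[c d] [/= Cc Cd] <-].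
  have B1 : B < B + 1 by rewrite ltrDl.
  by apply: le_trans (ler_normB _ _) (lerD _ _); exact: CB B1 _ _.
have normC a : C a -> eps <= `|a|.
  move=> Ca; apply: le_trans distC _; apply: ge_inf.
    by exists 0 => _ [x _ <-].
  by exists a => //; rewrite sub0r normrN.
(* Beyond norm [N = 2 * M], the ball of radius [M] about [c] covers [C] and stays at distance more
   than [M >= eta] from [0]. *)
have [[c [Cc Nc]]|CN] := pselect (exists c, C c /\ N < `|c|).
  exists c, M; split.
  - by rewrite /N in t_gt; lra.
  - by move=> a Ca; rewrite closed_ballE/closed_ball_/=; [exact: diamE|lra].
  - by rewrite le_dist_closed_ball//; move: Nc; rewrite /N; lra.
have {}CN a : C a -> `|a| <= N.
  by move=> Ca; rewrite leNgt; apply/negP => Na; apply: CN; exists a.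
have [f [f1 ef]] := norm_separation eps0 cC C0 normC.
have [df fn1] := f1.
have [|x [x1 sub]] := sliceC _ (compatible_affine hCC N^-1 0 CCC) _ f f1.
  move=> _ [c Cc <-]; rewrite /unit_ball/= addr0 normrZ gtr0_norm ?invr_gt0//.
  by rewrite ler_pdivrMl// mulr1 CN.
rewrite /unit_sphere/= in x1.
have teta : 0 < t - eta by lra.
exists (t *: x), (t - eta); split.
- by rewrite teta/=; lra.
- move=> c Cc; rewrite closed_ballE// /closed_ball_/=.
  rewrite leNgt; apply/negP => far.
  have v0 : 0 < `|t *: x - c| by apply: lt_trans far.
  (* Separating a singleton from [0] provides a norming functional. *)
  have [||a ->//|g [[dg g1] gv]] := @norm_separation _ _ [set t *: x - c] _ v0.
  + apply/convex_setP => _ _ s -> -> _ _ /=.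
    by rewrite -scalerDl addrC subrK scale1r.
  + by exists (t *: x - c).
  have := lt_le_trans far (gv _ erefl).
  rewrite (functionalB dg.1) (functionalZ dg.1).
  have g_le y : `|g y| <= `|y| by have := le_dual_norm y dg; rewrite g1 mul1r.
  have f_le y : `|f y| <= `|y| by have := le_dual_norm y df; rewrite fn1 mul1r.
  have t0 : 0 < t by lra.
  have [gx|gx] := leP (g x) (1 - delta / 2).
    have : t * g x <= t * (1 - delta / 2) by rewrite ler_pM2l.
    have := g_le c; rewrite ler_norml => /andP[gc _].
    by have := CN c Cc; lra.
  (* the slice also contains a normalized [g - (delta / 4) f], whose
     nonnegativity on [C] pushes [g] away from 0 there *)
  pose k := (1 + delta / 4)^-1.
  have k0 : 0 < k by rewrite invr_gt0; lra.
  have k1 : k + k * (delta / 4) = 1 by rewrite /k; field; lra.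
  have [|l [h [l0 [dh fh] gh]]] := sub (k *: g + (- (k * (delta / 4))) *: f).
    split; first split; first exact: dual_lin.
      apply: norm_on_le => // y y1; rewrite !fctE -[leRHS]k1.
      apply: le_trans (ler_normD _ _) _.
      have kd0 : 0 < k * (delta / 4) by rewrite mulr_gt0// divr_gt0.
      rewrite !normrZ normrN (gtr0_norm k0) (gtr0_norm kd0).
      by apply: lerD; rewrite ler_piMr ?(ltW k0) ?(ltW kd0)//;
        [exact: le_trans (g_le y) y1|exact: le_trans (f_le y) y1].
    have fx : f x <= 1 by rewrite -x1 (le_trans (ler_norm _)).
    have kgx : k * (1 - delta / 2) < k * g x by rewrite ltr_pM2l.
    have kfx : k * (delta / 4) * f x <= k * (delta / 4) * 1.
      by rewrite ler_wpM2l// mulr_ge0 ?divr_ge0// ltW.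
    (* Holds since [(1 - delta) * (1 + delta / 4) <= 1 - 3 * delta / 4]; the right-hand side bounds
       the new functional at [x] from below. *)
    have kdelta : 1 - delta <= k * (1 - 3 * delta / 4).
      by rewrite ler_pdivlMl; nra.
    suff : 1 - delta < k * g x + - (k * (delta / 4)) * f x by [].
    by lra.
  (* Hence [g c >= delta / 4 * eps >= eta], and [g (t *: x - c) <= t - eta] contradicts [far]. *)
  have gc : 0 <= g c - delta / 4 * f c.
    have hc : 0 <= h c.
      have dfh : dual (f - h).
        by have := dual_lin 1 (-1) df dh; rewrite scale1r scaleN1r.
      have [B B0 fhB] := dual_has_bound dfh.
      have : `|(f - h) (N^-1 *: c + 0)| <=
          norm_on [set N^-1 *: c + 0 | c in C] (f - h).
        apply: (@le_norm_on _ _ _ _ B) => [_ [b Cb <-]|]; last by exists c.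
        apply: le_trans (fhB _) _; rewrite ler_piMr// addr0 normrZ.
        by rewrite gtr0_norm ?invr_gt0// ler_pdivrMl// mulr1 CN.
      move=> /le_lt_trans/(_ fh); rewrite addr0.
      rewrite !fctE /= (functionalZ df.1) (functionalZ dh.1) -mulrBr normrM.
      rewrite gtr0_norm ?invr_gt0// ltr_pdivrMl//.
      have -> : N * (eps / (2 * N)) = eps / 2 by field; rewrite gt_eqF.
      by rewrite ltr_norml => /andP[_]; have := ef c Cc; lra.
    have : k * (g c - delta / 4 * f c) = l * h c.
      have /(congr1 (fun F : X -> R^o => F c)) := gh.
      by rewrite !fctE /GRing.scale/= => <-; ring.
    by move=> klh; rewrite -(@pmulr_rge0 _ k)// klh mulr_ge0.
  have : t * g x <= t.
    rewrite ler_piMr ?(ltW t0)//; apply: le_trans (ler_norm _) _.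
    by rewrite -x1.
  have : delta / 4 * eps <= delta / 4 * f c.
    by rewrite ler_pM2l ?ef// divr_gt0.
  by lra.
- by rewrite le_dist_closed_ball// normrZ x1 mulr1 gtr0_norm; lra.
Qed.

End Equivalence.

Theorem theorem4p6 (R : realType) (X : completeNormedModType R)
    (CC : set (set X)) (hCC : compatible_class CC) :
  UMIP CC <->
  (forall eps : R, 0 < eps ->
    exists delta : R, 0 < delta < 1 /\
      forall C : set X, CC C -> C `<=` unit_ball ->
      forall f : X -> R^o, dual_unit_sphere f ->
      exists x : X, unit_sphere x /\
        weak_star_slice x delta `<=` cone (ball_on C f eps)).
Proof.
split; [exact: UMIP_slices_in_cones|exact: slices_in_cones_UMIP].
Qed.
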